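(* Let $k \geq 4$, $t\ge 0$ and $n \geq 2k+t$ be integers. Let $\mathcal{F} \subseteq\binom{[n]}{k+t}$ and $\mathcal{G} \subseteq\binom{[n]}{k}$ be cross-intersecting families. If $\mathcal{F}$ is $(t+1)$-intersecting and $|\mathcal{F}| \geq 3$, then $$ |\mathcal{F}|+|\mathcal{G}| \leq\binom{n}{k}-\binom{n-k-t}{k}-\binom{n-k-t-1}{k-1}-\binom{n-k-t-2}{k-2}+3. $$ Moreover, for $n > 2k+t$, equality holds if and only if, under isomorphism (i.e. up to applying one permutation of $[n]$ simultaneously to $\mathcal{F}$ and $\mathcal{G}$), one of the following holds: (1) $\mathcal{F}=\{F_1, F_2, F_3\}$ with $F_i=[k+t-1]\cup \{k+t-1+i\}$ for each $i\in \{1,2,3\}$, and $\mathcal{G}=\left\{G \in\binom{[n]}{k}: G \cap F_i \neq\emptyset \text{ for every } i=1,2,3\right\}$; or (2) $k=4$, $\mathcal{F}=\{[t+3] \cup\{i\}: i \in\{t+4, \ldots, n\}\}$ and $\mathcal{G}=\left\{G \in\binom{[n]}{4}: G \cap[t+3] \neq \emptyset\right\}$.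
   Context: $[m]=\{1,\ldots,m\}$, and $\binom{[n]}{k}$ denotes the collection of all $k$-element subsets of $[n]$. A family $\mathcal{F}\subseteq 2^{[n]}$ is $s$-intersecting if $|F\cap F'|\ge s$ for all $F,F'\in\mathcal{F}$. Two families $\mathcal{F},\mathcal{G}\subseteq 2^{[n]}$ are cross-intersecting if $F\cap G\neq\emptyset$ for all $F\in\mathcal{F}$ and $G\in\mathcal{G}$. A permutation $\sigma$ of $[n]$ acts on a family by replacing each member $F$ with $\{\sigma(x):x\in F\}$; two families are isomorphic if one is the image of the other under such a permutation. *)

(* Defs.v *)
From mathcomp Require Import all_boot all_fingroup.

Set Implicit Arguments.
Unset Strict Implicit.
Unset Printing Implicit Defensive.

(* The ground set [n] = {1, ..., n} is modelled by 'I_n = {0, ..., n-1}, the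
   ordinal x standing for the integer x + 1; this is why x.+1 appears below. *)

Section Families.

Variable n : nat.

Implicit Types (F G : {set {set 'I_n}}) (s : 'S_n).

Definition ksubsets (k : nat) : {set {set 'I_n}} :=
  [set A : {set 'I_n} | #|A| == k].

Definition s_intersecting (s : nat) F : Prop :=
  forall A B, A \in F -> B \in F -> s <= #|A :&: B|.

Definition cross_intersecting F G : Prop :=
  forall A B, A \in F -> B \in G -> A :&: B != set0.

Definition fam_image s F : {set {set 'I_n}} := [set s @: (A : {set _}) | A : {set 'I_n} in F].

(* [m], as a subset of [n] *)
Definition seg (m : nat) : {set 'I_n} := [set x : 'I_n | x.+1 <= m].

(* {m}, as a subset of [n]; empty unless 1 <= m <= n *)
Definition point (m : nat) : {set 'I_n} := [set x : 'I_n | x.+1 == m].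

Definition petal (k t i : nat) : {set 'I_n} :=
  seg (k + t - 1) :|: point (k + t - 1 + i).

Definition extremal1 (k t : nat) F G : Prop :=
  F = [set petal k t 1; petal k t 2; petal k t 3] /\
  G = [set B in ksubsets k |
        [&& B :&: petal k t 1 != set0, B :&: petal k t 2 != set0
          & B :&: petal k t 3 != set0]].

Definition extremal2 (k t : nat) F G : Prop :=
  [/\ k = 4,
      F = [set seg (t + 3) :|: [set x] | x : 'I_n & t + 4 <= x.+1]
    & G = [set B in ksubsets 4 | B :&: seg (t + 3) != set0]].

End Families.

(* Main.v *)
Require Import Defs.
From mathcomp Require Import all_boot all_order all_algebra all_fingroup.
From mathcomp Require Import zify.

Set Implicit Arguments.
Unset Strict Implicit.
Unset Printing Implicit Defensive.

Import Order.TTheory GRing.Theory Num.Theory.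

(** With m = n - k - t, the complements of the members of F form a family P of
    m-sets satisfying |A \ B| < k for all A, B in P, and a k-set meets every
    member of F iff it is outside the k-shadow of P.  So one must bound
    |shadow P| - |P| from below.

    (a) Windows.  For every set M, passing from P to its members inside M does
    not increase |shadow P| - |P|: the inclusion matrix between the members A of
    P with A not in M and the k-sets of the shadow not in M has full row rank
    (in the style of Ray-Chaudhuri and Wilson).  Taking M minimal with at least
    three members of P inside, every point of M is missed by at most two of them.

    (b) Sparse families.  In such a window a double count bounds the number of
    members by about m, so it suffices to add the sets one at a time: a new set S
    contains a set X of size j that lies in none of the j previous ones, and the
    k-sets between X and S are new, which gives C(m-j, k-j) new k-sets.  Equality
    leaves three sets, or (k = 4) all m-sets, inside an (m+1)-set M.

    (c) Rigidity.  For such an M the comparison in (a) is strict unless all of P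
    lies in M. *)

(** * The inclusion matrix of a family *)

Section Shadow.

Variable T : finType.
Implicit Types (A B C M R S W X Y : {set T}) (P Q : {set {set T}}).

Section LinearAlgebra.

Local Open Scope ring_scope.

(** The hypothesis says that the rows of the 0-1 inclusion matrix, indexed by [P], are linearly
    independent over the rationals, so they cannot outnumber the columns. *)
Lemma leq_card_incidence P Q :
  (forall c : {set T} -> rat,
     (forall Y, Y \in Q -> \sum_(A in P | Y \subset A) c A = 0) ->
     forall A, A \in P -> c A = 0) ->
  (#|P| <= #|Q|)%N.
Proof.
move=> inj.
pose N : 'M[rat]_(#|P|, #|Q|) :=
  \matrix_(i < #|P|, j < #|Q|) (enum_val j \subset enum_val i)%:R.
suff: row_free N by move/eqP <-; apply: rank_leq_col.
apply/inj_row_free => v vN0.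
apply/rowP => i0; rewrite mxE; have A0P : enum_val i0 \in P := enum_valP i0.
pose c A := v 0 (enum_rank_in A0P A).
have c0 : forall A, A \in P -> c A = 0.
  apply: inj => Y YQ.
  have /rowP/(_ (enum_rank_in YQ Y)) := vN0; rewrite !mxE => {2}<-.
  rewrite big_mkcondr big_enum_val /=; apply: eq_bigr => i _.
  rewrite !mxE /c enum_valK_in enum_rankK_in //.
  by case: ifP; rewrite ?mulr1 ?mulr0.
rewrite -(c0 _ A0P).
by rewrite /c enum_valK_in.
Qed.

(** Keeping the points required in [A] (those of [R]) apart from the points forbidden in [A] (those
    of [S]) lets inclusion-exclusion run one point at a time. *)
Definition pairing P (c : {set T} -> rat) (R S : {set T}) :=
  \sum_(A in P | (R \subset A) && (S \subset ~: A)) c A.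

Lemma pairing_split P (c : {set T} -> rat) R S y :
  pairing P c R S = pairing P c (y |: R) S + pairing P c R (y |: S).
Proof.
rewrite /pairing (bigID (fun A => y \in A)) /=; congr (_ + _); apply: eq_bigl => A.
  by rewrite subUset sub1set -!andbA; case: (y \in A); rewrite ?andbF ?andbT.
by rewrite subUset sub1set inE -!andbA; case: (y \in A); rewrite ?andbF ?andbT.
Qed.

(* The hypothesis propagates from k-sets down to smaller sets, hence, by
   inclusion-exclusion, to sums over the A disjoint from a small S.  A subset S of
   B in P that is too large for this meets every A in P, as |B \ A| is small; so
   all sums over A containing R and disjoint from S, with R and S inside B,
   vanish.  R = B isolates c B. *)
Lemma incidence_injective P X m k (c : {set T} -> rat) :
  {in P, forall A : {set T}, #|A| = m} -> {in P, forall A : {set T}, X \subset A} ->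
  {in P &, forall A B : {set T}, #|X| + #|A :\: B| <= k}%N -> (k <= m)%N ->
  (forall Y, #|Y| = k -> X \subset Y -> \sum_(A in P | Y \subset A) c A = 0) ->
  {in P, forall A, c A = 0}.
Proof.
move=> Pm PX Pk km cY B BP.
have f0 R : pairing P c R set0 = \sum_(A in P | R \subset A) c A.
  by apply: eq_bigl => A; rewrite sub0set andbT.
have down j R : (k - #|R| <= j)%N -> X \subset R -> (#|R| <= k)%N ->
    pairing P c R set0 = 0.
  elim: j R => [|j IH] R jR XR Rk.
    by rewrite f0 cY //; apply/eqP; rewrite eqn_leq Rk -subn_eq0 -leqn0.
  move: (Rk); rewrite leq_eqVlt => /orP [/eqP Rk'|Rk']; first by rewrite f0 cY.
  (* Each [A] containing [R] is counted once per point of [A :\: R], hence [m - #|R|] times, a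
     positive number because [#|R| < k <= m]. *)
  have E : \sum_(y in ~: R) pairing P c (y |: R) set0 = 0.
    apply: big1 => y; rewrite inE => yR; apply: IH.
    - by rewrite cardsU1 yR; lia.
    - by rewrite (subset_trans XR) ?subsetUr.
    - by rewrite cardsU1 yR; lia.
  move: E; rewrite (eq_bigr (fun y => \sum_(A in P | R \subset A)
    (if y \in A then c A else 0))); last first.
    move=> y _; rewrite f0 -big_mkcondr; apply: eq_bigl => A.
    by rewrite subUset sub1set -!andbA; congr andb; apply: andbC.
  rewrite exchange_big /= (eq_bigr (fun A => c A *+ (m - #|R|))); last first.
    move=> A /andP [AP RA]; rewrite -big_mkcondr sumr_const; congr (_ *+ _).
    by rewrite -(Pm _ AP) -cardsDS //; apply: eq_card => y; rewrite unfold_in !inE.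
  rewrite sumrMnl -f0 => /eqP; rewrite mulrn_eq0 => /orP [|/eqP //].
  by lia.
have low j S R : (#|S| <= j)%N -> (#|X| + #|R| + #|S| <= k)%N -> pairing P c R S = 0.
  elim: j S R => [|j IH] S R Sj RS.
    move: Sj; rewrite leqn0 cards_eq0 => /eqP ->.
    rewrite (_ : pairing _ _ _ _ = pairing P c (X :|: R) set0).
      by apply: (down k); rewrite ?leq_subr ?subsetUl // cardsU; lia.
    rewrite !f0; apply: eq_bigl => A; rewrite subUset.
    by case AP: (A \in P) => //=; rewrite (PX _ AP).
  case: (set_0Vmem S) => [->|[y yS]]; first by apply: IH; rewrite ?cards0; lia.
  have := pairing_split P c R (S :\ y) y; rewrite setD1K //.
  move: (cardsD1 y S) (leq_card_setU [set y] R); rewrite yS cards1 => Sy [yR _].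
  rewrite (IH (S :\ y)) ?(IH (S :\ y) (y |: R)) ?add0r => [<-||||] //; lia.
have high j R S : (#|R| <= j)%N -> S \subset B -> R \subset B ->
    pairing P c R S = 0.
  elim: j R S => [|j IH] R S Rj SB RB.
    move: Rj; rewrite leqn0 cards_eq0 => /eqP ->.
    case: (leqP (#|X| + #|S|) k) => [Sk|kS].
      by apply: (low #|S|); rewrite // cards0; lia.
    apply: big1 => A /and3P [AP _ SA].
    have := Pk _ _ BP AP; rewrite leqNgt (leq_trans kS) // leq_add2l.
    by apply: subset_leq_card; rewrite subsetD SB disjoints_subset.
  case: (set_0Vmem R) => [->|[y yR]]; first by apply: IH; rewrite ?cards0 ?sub0set.
  have := pairing_split P c (R :\ y) S y; rewrite setD1K //.
  have yB : y \in B by apply: (subsetP RB).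
  have RyB : R :\ y \subset B by rewrite (subset_trans _ RB) ?subD1set.
  move: (cardsD1 y R); rewrite yR => Ry.
  rewrite (IH (R :\ y) S) ?(IH (R :\ y) (y |: S)) ?addr0 => [<-||||||] //; try lia.
  by rewrite subUset sub1set yB.
have := high _ B set0 (leqnn _) (sub0set _) (subxx _).
rewrite f0 (bigD1 B) ?BP ?subxx //= big1 ?addr0 // => A /andP [/andP [AP BA]] /negP[].
by rewrite eq_sym eqEcard BA (Pm _ AP) (Pm _ BP) leqnn.
Qed.

End LinearAlgebra.

(** * Shadows, and the sets that leave a window *)

Definition shadow k P := [set Y : {set T} | (#|Y| == k) && [exists A in P, Y \subset A]].

Lemma shadowP k P Y :
  reflect (#|Y| = k /\ exists2 A, A \in P & Y \subset A) (Y \in shadow k P).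
Proof.
rewrite inE; apply: (iffP andP) => [[/eqP Yk /exists_inP]|[Yk YP]] //.
by rewrite Yk; split=> //; apply/exists_inP.
Qed.

(** For [B] not inside [W], fix [z] in [B] outside [W]. Every [Y] containing [z |: X] also leaves
    [W], so the equations at such [Y] are available and concern only members through [z |: X];
    [incidence_injective] with [z |: X] in place of [X] gives [c B = 0]. The strict bound makes room
    for [z]. *)
Lemma leq_card_shadow_outside P X W m k :
  {in P, forall A : {set T}, #|A| = m} -> (k <= m)%N -> X \subset W ->
  {in P &, forall A B : {set T}, #|X| + #|A :\: B| < k}%N ->
  (#|[set A in P | (X \subset A) && ~~ (A \subset W)]| <=
   #|[set Y in shadow k P | (X \subset Y) && ~~ (Y \subset W)]|)%N.
Proof.
move=> Pm km XW Pk; apply: leq_card_incidence => c cY B.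
rewrite inE => /and3P [BP XB /subsetPn [z zB zW]].
have zX : z \notin X by apply: contra zW; apply: (subsetP XW).
apply: (@incidence_injective [set A in P | z |: X \subset A] (z |: X) m k) => //.
- by move=> A; rewrite inE => /andP [/Pm].
- by move=> A; rewrite inE => /andP [].
- move=> A C; rewrite !inE => /andP [AP _] /andP [CP _].
  by rewrite cardsU1 zX; apply: Pk.
- move=> Y Yk; rewrite subUset sub1set => /andP [zY XY].
  case YP: (Y \in shadow k P).
    rewrite -[RHS](cY Y); last first.
      by rewrite inE YP XY; apply/subsetPn; exists z.
    apply: eq_bigl => A; rewrite !inE subUset sub1set.
    case YA: (Y \subset A); rewrite ?andbF //= !andbT.
    rewrite (subsetP YA) // (subset_trans XY YA) /=; congr andb; apply/esym.
    by apply/subsetPn; exists z => //; apply: (subsetP YA).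
  apply: big1 => A /andP []; rewrite inE => /andP [AP _] YA.
  by move/shadowP: YP => []; split=> //; exists A.
- by rewrite inE BP subUset sub1set zB.
Qed.

End Shadow.
(** * Adding sets one at a time *)

Section Greedy.

Variable T : finType.
Implicit Types (A B C M R S W X Y : {set T}) (P Q : {set {set T}}).

Lemma shadowS k P Q : P \subset Q -> shadow k P \subset shadow k Q.
Proof.
move=> PQ; apply/subsetP => Y /shadowP [Yk [A AP YA]]; apply/shadowP.
by split=> //; exists A => //; apply: (subsetP PQ).
Qed.

Definition layer k X A := [set Y : {set T} | [&& #|Y| == k, X \subset Y & Y \subset A]].

Lemma card_layer k X A :
  X \subset A -> #|X| <= k -> #|layer k X A| = 'C(#|A| - #|X|, k - #|X|).
Proof.
move=> XA Xk; rewrite -cardsDS // -cards_draws.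
have disj Y : Y \subset A :\: X -> Y :\: X = Y.
  by rewrite subsetD => /andP [_]; apply: setDidPl.
rewrite -[RHS](card_in_imset (f := fun Y => X :|: Y)); last first.
  move=> Y Z; rewrite !inE => /andP [/disj YX _] /andP [/disj ZX _] E.
  by rewrite -YX -ZX -[_ :\: _]set0U -[Z :\: _]set0U -(setDv X) -!setDUl E.
apply: eq_card => Y; rewrite !inE; apply/and3P/imsetP => [[/eqP Yk XY YA]|].
  exists (Y :\: X); last by rewrite -{1}(setIidPr XY) setID.
  by rewrite inE setSD // cardsDS // Yk eqxx.
move=> [Z]; rewrite inE => /andP [ZA /eqP Zk] ->.
rewrite subsetUl subUset XA (subset_trans ZA) ?subsetDl // cardsU.
rewrite -{2}(disj _ ZA) setIDA setIC -setIDA setDv setI0 cards0 Zk; split=> //.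
by apply/eqP; lia.
Qed.

Lemma subset_interpolate X A j :
  X \subset A -> #|X| <= j <= #|A| -> exists Y, [/\ #|Y| = j, X \subset Y & Y \subset A].
Proof.
move=> XA /andP [Xj jA].
have : 0 < #|layer j X A| by rewrite card_layer // bin_gt0; lia.
by case/card_gt0P => Y; rewrite inE => /and3P [/eqP ? ? ?]; exists Y.
Qed.

Lemma shadow1 k A : shadow k [set A] = layer k set0 A.
Proof.
apply/setP => Y; rewrite !inE sub0set /=; congr andb.
by apply/exists_inP/idP => [[B]|YA]; [rewrite inE => /eqP -> | exists A; rewrite ?inE].
Qed.

Lemma card_shadow_add k P A Q :
  (forall Y, Y \in Q -> [/\ #|Y| = k, Y \subset A & forall B, B \in P -> ~~ (Y \subset B)]) ->
  #|shadow k P| + #|Q| <= #|shadow k (A |: P)|.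
Proof.
move=> QA; have /leqifP := leq_card_setU (shadow k P) Q.
rewrite ifT; last first.
  rewrite disjoint_sym disjoints_subset; apply/subsetP => Y /QA [_ _ YP].
  by rewrite inE; apply/negP => /shadowP [_ [B /YP /negP]].
move=> /eqP <-; apply: subset_leq_card; rewrite subUset shadowS ?subsetUr //=.
apply/subsetP => Y /QA [Yk YA _]; apply/shadowP; split=> //.
by exists A => //; rewrite setU11.
Qed.

(** Enlarge [X] inside [A] to a set [Z] of exactly [j] points. No member of [P] contains a set above
    [Z], so all k-sets between [Z] and [A] are new. *)
Lemma card_shadow_add_hitting k P A X j :
  X \subset A -> #|X| <= j -> j <= k <= #|A| ->
  (forall B, B \in P -> ~~ (X \subset B)) ->
  #|shadow k P| + 'C(#|A| - j, k - j) <= #|shadow k (A |: P)|.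
Proof.
move=> XA Xj /andP [jk kA] XP.
have [|Z [Zj XZ ZA]] := subset_interpolate (j := j) XA; first by lia.
rewrite -Zj -card_layer ?Zj //; apply: card_shadow_add => Y.
rewrite inE => /and3P [/eqP Yk ZY YA]; split=> // B /XP; apply: contra.
by apply: subset_trans (subset_trans XZ ZY).
Qed.

(** One point of [A :\: B] for each [B] gives a set that hits all these differences and so lies in
    no [B]. *)
Lemma hitting_set P A :
  (forall B, B \in P -> ~~ (A \subset B)) ->
  exists X, [/\ X \subset A, #|X| <= #|P| & forall B, B \in P -> ~~ (X \subset B)].
Proof.
have [r] := ubnP #|P|; elim: r P => // r IH P; rewrite ltnS => Pr AP.
case: (set_0Vmem P) => [->|[B BP]].
  by exists set0; rewrite sub0set cards0; split=> // B; rewrite inE.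
have [||X [XA XP XB]] := IH (P :\ B).
- by move: Pr; rewrite (cardsD1 B) BP.
- by move=> C; rewrite inE => /andP [_ /AP].
have /subsetPn [x xA xB] := AP _ BP.
exists (x |: X); split.
- by rewrite subUset sub1set xA.
- by rewrite (cardsD1 B P) BP cardsU1; move: XP; case: (x \in X) => /=; lia.
- move=> C CP; rewrite subUset sub1set negb_and.
  by have [->|CB] := eqVneq C B; rewrite ?xB // XB ?orbT // !inE CB.
Qed.

Lemma uniform_nsub m P A B :
  {in P, forall A : {set T}, #|A| = m} -> A \in P -> B \in P -> A != B -> ~~ (A \subset B).
Proof.
by move=> Pm AP BP; apply: contra => AB; rewrite eqEcard AB !Pm /=.
Qed.

(** [X0] separates every new member from all of [P0] at once. Each of the [j] members added before
    costs one more point, so the next has a hitting set of size at most [#|X0| + j]. *)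
Lemma card_shadow_greedy k m P P0 X0 r :
  {in P, forall A : {set T}, #|A| = m} -> P0 \subset P -> k <= m ->
  (forall B, B \in P0 -> ~~ (X0 \subset B)) ->
  (forall A, A \in P :\: P0 -> X0 \subset A) ->
  r <= #|P :\: P0| -> #|X0| + r <= k.+1 ->
  #|shadow k P0| + \sum_(j < r) 'C(m - (#|X0| + j), k - (#|X0| + j)) <= #|shadow k P|.
Proof.
move=> Pm P0P km P0X PX rP rk.
suff [P' [_ P'P _]] : exists P', [/\ P0 \subset P', P' \subset P, #|P' :\: P0| = r &
    #|shadow k P0| + \sum_(j < r) 'C(m - (#|X0| + j), k - (#|X0| + j))
      <= #|shadow k P'|].
  by move/leq_trans; apply; apply/subset_leq_card/shadowS.
elim: r rP rk => [|r IH] rP rk.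
  by exists P0; rewrite big_ord0 setDv cards0 addn0.
have [||P' [P0P' P'P P'r P'sh]] := IH; try lia.
have : ~~ (P :\: P0 \subset P' :\: P0).
  by apply/negP => /subset_leq_card; lia.
move=> /subsetPn [A]; rewrite !inE => /andP [AP0 AP]; rewrite AP0 /= => AP'.
have [B|X1 [X1A X1r X1P]] := @hitting_set (P' :\: P0) A.
  rewrite inE => /andP [_ BP']; apply: (uniform_nsub Pm) => //.
    by apply: (subsetP P'P).
  by apply: contraNneq AP' => ->.
exists (A |: P'); split.
- by rewrite (subset_trans P0P') ?subsetUr.
- by rewrite subUset sub1set AP.
- by rewrite setDUl (_ : [set A] :\: P0 = [set A]) ?cardsU1 ?inE ?AP0 ?(negPf AP') ?P'r //;
    apply/setDidPl; rewrite disjoints_subset sub1set inE.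
rewrite big_ord_recr /= addnA.
apply: leq_trans (card_shadow_add_hitting (X := X0 :|: X1) (j := #|X0| + r) _ _ _ _).
- by rewrite (Pm _ AP) leq_add2r.
- by rewrite subUset X1A PX // inE AP0.
- by rewrite cardsU; lia.
- by rewrite (Pm _ AP) km; lia.
- move=> B BP'; rewrite subUset negb_and.
  by have [/P0X ->|BP0] := boolP (B \in P0); rewrite // X1P ?orbT // inE BP0.
Qed.

Lemma card_shadow_sum k m P r :
  {in P, forall A : {set T}, #|A| = m} -> k <= m -> r <= #|P| -> r <= k.+1 ->
  \sum_(j < r) 'C(m - j, k - j) <= #|shadow k P|.
Proof.
move=> Pm km rP rk.
have := @card_shadow_greedy k m P set0 set0 r Pm (sub0set _) km.
rewrite cards0 setD0 => /(_ _ _ rP rk) H; apply: leq_trans (H _ _).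
- exact: leq_addl.
- by move=> B; rewrite inE.
- by move=> A; rewrite sub0set.
Qed.

End Greedy.
(** * Families in a minimal window *)

Section MinimalShadow.

Variable T : finType.
Implicit Types (A B C M R S W X Y : {set T}) (P Q : {set {set T}}).

Lemma bin_pascal m k : 0 < m -> 0 < k -> 'C(m, k) = 'C(m - 1, k) + 'C(m - 1, k - 1).
Proof. by case: m k => [|m] [|k] // _ _; rewrite binS !subn1. Qed.

Lemma leq_bin m k : 0 < k < m -> m <= 'C(m, k).
Proof.
elim: m k => [|m IH] [|k] //=; rewrite ltnS binS => km.
have [<-|km'] := eqVneq k.+1 m; first by rewrite binn binSn; lia.
have {}IH : m <= 'C(m, k.+1) by apply: IH; lia.
have : 0 < 'C(m, k) by rewrite bin_gt0; lia.
by move: IH; lia.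
Qed.

(* The size of the k-shadow of three m-subsets of an (m+1)-set. *)
Definition three_shadow m k := 'C(m, k) + 'C(m - 1, k - 1) + 'C(m - 2, k - 2).

(** Double count of the pairs of a member [A] and a point of [M] outside [A]. *)
Lemma card_missing_pairs m d P M :
  {in P, forall A : {set T}, #|A| = m} -> {in P, forall A : {set T}, A \subset M} ->
  {in M, forall y, #|[set A in P | y \notin A]| <= d} ->
  #|P| * (#|M| - m) <= d * #|M|.
Proof.
move=> Pm PM Md.
have -> : #|P| * (#|M| - m) = \sum_(A in P) \sum_(y in M) (y \notin A).
  rewrite -sum_nat_const; apply: eq_bigr => A AP.
  rewrite -(Pm _ AP) -cardsDS ?PM // -sum1_card -big_mkcondr.
  by apply: eq_bigl => y; rewrite inE andbC.
rewrite exchange_big mulnC -sum_nat_const /=; apply: leq_sum => y /Md; apply: leq_trans.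
rewrite -big_mkcondr sum1_card; apply: eq_leq; apply: eq_card => A.
by rewrite unfold_in inE.
Qed.

(** [A1] misses two points [x], [x'] of [M], and [A2], [A3] contain [x], with [x'] in [A2] too. The
    k-subsets of [A2] through [x] are new, and so is one through [x'] avoiding [x], which gives
    strictness. [A3] adds those through [x] and some [z] in [A3 :\: A2]. *)
Lemma card_shadow_spread3 m k P M :
  3 <= k < m -> {in P, forall A : {set T}, #|A| = m} ->
  {in P, forall A : {set T}, A \subset M} -> 3 <= #|P| -> m.+1 < #|M| ->
  {in M, forall y, #|[set A in P | y \notin A]| <= 1} ->
  three_shadow m k < #|shadow k P|.
Proof.
move=> /andP [k3 km] Pm PM /card_gt2P [A1 [A2 [A3 [[P1 P2 P3] [n12 n23 n31]]]]] Mm M1.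
have P_in y A B : y \in M -> A \in P -> B \in P -> A != B -> y \notin A -> y \in B.
  move=> yM AP BP AB yA; apply: contraLR (M1 _ yM) => yB; rewrite -ltnNge.
  by apply/card_gt1P; exists A, B; rewrite !inE AP BP.
have : 1 < #|M :\: A1| by rewrite cardsDS ?(Pm A1) ?PM //; clear -Mm; lia.
move=> /card_gt1P [x [x' []]]; rewrite !inE => /andP [x1 xM] /andP [x1' xM'] xx'.
have x2 : x \in A2 by apply: (P_in x A1).
have x3 : x \in A3 by apply: (P_in x A1); rewrite // eq_sym.
have x2' : x' \in A2 by apply: (P_in x' A1).
have /subsetPn [z z3 z2] : ~~ (A3 \subset A2).
  by apply: (uniform_nsub Pm); rewrite // eq_sym.
have [||Y [Yk xY YA]] := @subset_interpolate _ [set x'] (A2 :\ x) k.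
- by rewrite sub1set !inE x2' eq_sym xx'.
- rewrite cards1; move: (cardsD1 x A2); rewrite x2 (Pm A2) // => E.
  by clear -E km k3; lia.
have s2 : #|shadow k [set A1]| + #|Y |: layer k [set x] A2| <= #|shadow k (A2 |: [set A1])|.
  apply: card_shadow_add => Z; rewrite !inE => /orP [/eqP ->|/and3P [/eqP Zk xZ ZA]].
    split=> //; first by rewrite (subset_trans YA) ?subD1set.
    move=> B; rewrite inE => /eqP ->; apply: contra x1' => YA1.
    by rewrite -sub1set (subset_trans xY).
  split=> // B; rewrite inE => /eqP ->; apply: contra x1 => ZA1.
  by rewrite -sub1set (subset_trans xZ).
have s3 : #|shadow k (A2 |: [set A1])| + 'C(#|A3| - 2, k - 2) <=
    #|shadow k (A3 |: (A2 |: [set A1]))|.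
  apply: (@card_shadow_add_hitting _ _ _ _ [set x; z]).
  - by rewrite subUset !sub1set x3.
  - by rewrite cards2; case: (_ == _).
  - by rewrite (Pm A3) //; clear -km k3; lia.
  - move=> B; rewrite !inE subUset !sub1set => /orP [] /eqP ->; rewrite ?(negPf z2) ?andbF //.
    by rewrite negb_and x1.
have s : #|shadow k (A3 |: (A2 |: [set A1]))| <= #|shadow k P|.
  by apply/subset_leq_card/shadowS; rewrite !subUset !sub1set P1 P2 P3.
move: s2 s3; rewrite shadow1 card_layer ?sub0set ?cards0 // cardsU1.
have -> : Y \notin layer k [set x] A2.
  rewrite inE sub1set; apply/negP => /and3P [_ xY' _].
  by move: (subsetP YA _ xY'); rewrite !inE eqxx.
have k1 : 0 < k by clear -k3; lia.
rewrite card_layer ?sub1set ?cards1 ?Pm // ?subn0 /three_shadow.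
by move=> s2 s3; clear -s s2 s3; lia.
Qed.

(* A point y missed by only two members A1, A2 hits both at once, so from the third
   member on the hitting set X has one element fewer than in the generic count. *)
Lemma card_shadow_two_missing m k P M y :
  4 <= k < m -> {in P, forall A : {set T}, #|A| = m} ->
  {in P, forall A : {set T}, A \subset M} -> 3 <= #|P| ->
  {in M, forall y, #|[set A in P | y \notin A]| <= 2} ->
  y \in M -> 1 < #|[set A in P | y \notin A]| ->
  three_shadow m k + #|P| < #|shadow k P| + 3.
Proof.
move=> /andP [k4 km] Pm PM P3 M2 yM y2.
have {y2} : #|[set A in P | y \notin A]| == 2 by rewrite eqn_leq M2.
set P0 := [set A in P | _] => /eqP P02.
have P0P : P0 \subset P by apply/subsetP => A; rewrite inE => /andP [].
(* The union of the two members missing [y] has more than [m] points and avoids [y], so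
   [#|M| >= m + 2]. With [d = #|M| - m >= 2], the double count [#|P| * d <= 2 * (m + d)] gives the
   claim. *)
have P_le : #|P| <= m.+2.
  have [A [B [AP0 BP0 AB]]] : exists A B, [/\ A \in P0, B \in P0 & A != B].
    by apply/card_gt1P; rewrite P02.
  move: AP0 BP0; rewrite !inE => /andP [AP yA] /andP [BP yB].
  have AUB : #|A| < #|A :|: B|.
    apply: proper_card; rewrite properE subsetUl subUset subxx /=.
    by rewrite (uniform_nsub Pm) // eq_sym.
  have UM : #|A :|: B| <= #|M :\ y|.
    by apply: subset_leq_card; rewrite subsetD1 subUset !PM // inE negb_or yA.
  have := card_missing_pairs Pm PM M2; move: (cardsD1 y M) AUB; rewrite yM (Pm A) //.
  have -> : #|M| = m + (#|M| - m) by have := subset_leq_card (PM _ AP); rewrite (Pm A) //; lia.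
  by rewrite addKn; nia.
have P0m : {in P0, forall A : {set T}, #|A| = m} by move=> A /(subsetP P0P) /Pm.
have := card_shadow_sum (r := 2) P0m (ltnW km); rewrite P02 => /(_ isT) s0.
have PD : #|P :\: P0| = #|P| - 2 by rewrite cardsDS // P02.
have s r : r <= #|P| - 2 -> r <= 3 ->
    #|shadow k P0| + \sum_(j < r) 'C(m - (1 + j), k - (1 + j)) <= #|shadow k P|.
  move=> rP r3; rewrite -(cards1 y); apply: (card_shadow_greedy Pm P0P (ltnW km)).
  - by move=> A; rewrite inE sub1set => /andP [].
  - by move=> A; rewrite !inE sub1set => /andP [] + AP; rewrite AP /= negbK.
  - by rewrite PD.
  - by rewrite cards1; lia.
move: s0; rewrite !big_ord_recr big_ord0 /= add0n !subn0 ltnS (ltnW (ltnW (ltnW k4))).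
move=> /(_ isT) s0.
have b1 : 'C(m - 1, k - 1) = 'C(m - 2, k - 1) + 'C(m - 2, k - 2).
  by rewrite bin_pascal ?subn_gt0 -?subnDA //; lia.
have b2 : 0 < 'C(m - 2, k - 1) by rewrite bin_gt0; lia.
have b3 : m - 1 <= 'C(m - 1, k - 1) by apply: leq_bin; lia.
have b4 : 0 < 'C(m - 3, k - 3) by rewrite bin_gt0; lia.
(* For [#|P|] equal to 3, to 4, or at least 5, take [r] = 1, 2, 3. The excess over [three_shadow] is
   at least ['C(m - 2, k - 1)], then ['C(m - 1, k - 1) >= m - 1], then at least [m], and
   [#|P| - 3 <= m - 1]. *)
move: (s 1) (s 2) (s 3); rewrite !big_ord_recr !big_ord0 /= !add1n add0n /three_shadow.
clear -s0 b1 b2 b3 b4 P3 P_le k4 km => s1 s2 s3.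
by set p := #|P| in P3 P_le s1 s2 s3 *; lia.
Qed.

(** A point missed twice gives strictness at once. Otherwise the double count yields
    [#|P| <= m + 1], and the terms of the greedy sum after the third are compared with
    [#|P| - 3]. *)
Lemma card_shadow_sparse m k P M :
  4 <= k < m -> {in P, forall A : {set T}, #|A| = m} ->
  {in P, forall A : {set T}, A \subset M} -> 3 <= #|P| ->
  {in M, forall y, #|[set A in P | y \notin A]| <= 2} ->
  three_shadow m k + #|P| < #|shadow k P| + 3 \/
  [/\ three_shadow m k + #|P| <= #|shadow k P| + 3, #|M| = m.+1
    & #|P| = 3 \/ (k = 4 /\ #|P| = m.+1)].
Proof.
move=> km4 Pm PM P3 M2; have /andP [k4 km] := km4.
case: (boolP [exists y in M, 1 < #|[set A in P | y \notin A]|]).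
  by move=> /exists_inP [y yM y2]; left; apply: (card_shadow_two_missing km4 Pm PM P3 M2 yM).
rewrite negb_exists_in => /forall_inP M1'.
have M1 : {in M, forall y, #|[set A in P | y \notin A]| <= 1}.
  by move=> y /M1'; rewrite -leqNgt.
have pairs := card_missing_pairs Pm PM M1.
have Mm : m < #|M|.
  have [A [B [AP BP AB]]] : exists A B, [/\ A \in P, B \in P & A != B].
    by apply/card_gt1P; apply: leq_trans P3.
  rewrite -(Pm _ AP); apply: proper_card; rewrite properE PM //=.
  apply: contra (uniform_nsub Pm BP AP _); last by rewrite eq_sym.
  by apply: subset_trans; apply: PM.
have s r := card_shadow_sum (r := r) Pm (ltnW km).
set p := #|P| in P3 pairs s *.
have [E3|P4] : p = 3 \/ 4 <= p by lia.
  have := s 3; rewrite !big_ord_recr big_ord0 /= add0n !subn0 => s3.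
  have [Mm1|Mm2] : #|M| = m.+1 \/ m.+1 < #|M| by lia.
    by right; split=> //; [rewrite /three_shadow; lia | left].
  left; rewrite E3 ltn_add2r; apply: (card_shadow_spread3 _ Pm PM) => //.
  by rewrite km (ltnW k4).
have P_le : p <= m.+1 by nia.
have b3 : m - 3 <= 'C(m - 3, k - 3) by apply: leq_bin; lia.
have [E4|P5] : p = 4 \/ 5 <= p by lia.
  by left; have := s 4; rewrite !big_ord_recr big_ord0 /= !subn0 /three_shadow; lia.
(* For [k = 4] the fourth and fifth terms add up to [m - 2], so only [#|P| = m + 1] can be tight,
   and the double count then forces [#|M| = m + 1]. For larger [k] they give at least
   [2m - 7 > m - 2]. *)
have [E4|k5] : k = 4 \/ 5 <= k by lia.
  have := s 5; rewrite !big_ord_recr big_ord0 /= !subn0 (_ : k - 4 = 0) ?E4 // bin0 -E4 => s5.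
  have [E|P_lt] : p = m.+1 \/ p <= m by lia.
    by right; split; [rewrite /three_shadow; lia | nia | right].
  by left; rewrite /three_shadow; lia.
have b4 : m - 4 <= 'C(m - 4, k - 4) by apply: leq_bin; lia.
by left; have := s 5; rewrite !big_ord_recr big_ord0 /= !subn0 /three_shadow; lia.
Qed.

End MinimalShadow.
(** * Windows, rigidity and the shadow bound *)

Section ShadowBound.

Variable T : finType.
Implicit Types (A B C M R S W X Y : {set T}) (P Q : {set {set T}}).

Lemma cards_split (U : finType) (D : {set U}) (p : pred U) :
  #|D| = #|[set x in D | p x]| + #|[set x in D | ~~ p x]|.
Proof.
rewrite -(cardsID [set x | p x] D); congr (_ + _); apply: eq_card => x.
  by rewrite !inE.
by rewrite !inE andbC.
Qed.

Lemma ssetI_sub P M : P ::&: M \subset P.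
Proof. by apply/subsetP => A; rewrite inE => /andP []. Qed.

Lemma card_shadow_window m k P M :
  {in P, forall A : {set T}, #|A| = m} -> k <= m ->
  {in P &, forall A B : {set T}, #|A :\: B| < k} ->
  #|shadow k (P ::&: M)| + #|P| <= #|shadow k P| + #|P ::&: M|.
Proof.
move=> Pm km Pk.
have := leq_card_shadow_outside (X := set0) (W := M) Pm km (sub0set _).
rewrite cards0 => /(_ Pk) out.
rewrite (cards_split P (fun A => A \subset M)).
rewrite (cards_split (shadow k P) (fun Y => Y \subset M)).
have inn : #|shadow k (P ::&: M)| <= #|[set Y in shadow k P | Y \subset M]|.
  apply/subset_leq_card/subsetP => Y YP; rewrite inE (subsetP (shadowS _ (ssetI_sub P M))) //=.
  by move: YP => /shadowP [_ [A]]; rewrite inE => /andP [_ AM] /subset_trans; apply.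
have -> : [set A in P | A \subset M] = P ::&: M by [].
rewrite addnCA addnC leq_add2r (leq_add inn) //.
by congr (_ <= _): out; apply: eq_card => A; rewrite !inE sub0set.
Qed.

(** Take [M'] minimal among the supersets of [M] containing a member not inside [M]. By minimality a
    point [x] of such a member outside [M] lies in every such member. Splitting the shadow by [x]
    gives two comparisons, one of which is strict. *)
Lemma card_shadow_window_lt m k P M :
  4 <= k < m -> {in P, forall A : {set T}, #|A| = m} ->
  {in P &, forall A B : {set T}, #|A :\: B| < k} ->
  #|M| = m.+1 -> ~~ (P \subset P ::&: M) ->
  #|shadow k (P ::&: M)| + #|P| < #|shadow k P| + #|P ::&: M|.
Proof.
move=> /andP [k4 km] Pm Pk Mm PM.
pose over M' := (M \subset M') && [exists A in P, (A \subset M') && ~~ (A \subset M)].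
have [M' /minsetP [/andP [MM' /exists_inP [A0 A0P /andP [A0M' A0M]]] minM'] _] :
    {M' | minset over M' & M' \subset setT}.
  apply: minset_exists; rewrite /over subsetT /=.
  have /subsetPn [A AP] := PM; rewrite inE AP /= => AM.
  by apply/exists_inP; exists A; rewrite // subsetT.
have win := card_shadow_window M' Pm (ltnW km) Pk.
set P' := P ::&: M' in win.
suff : #|shadow k (P ::&: M)| + #|P'| < #|shadow k P'| + #|P ::&: M|.
  by move: win; clear; lia.
have P'P : P' \subset P := ssetI_sub P M'.
have P'm : {in P', forall A : {set T}, #|A| = m} by move=> A /(subsetP P'P) /Pm.
have P'k : {in P' &, forall A B : {set T}, #|A :\: B| < k}.
  by move=> A B /(subsetP P'P) AP /(subsetP P'P); apply: Pk.
have A0P' : A0 \in P' by rewrite inE A0P.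
have /subsetPn [x xA0 xM] := A0M.
have xM' : x \in M' by apply: (subsetP A0M').
have through A : A \in P' -> (x \in A) = ~~ (A \subset M).
  move=> AP'; have [xA|xA] := boolP (x \in A).
    by apply/esym/subsetPn; exists x.
  apply/esym/negbF/contraT => AM.
  have : M' :\ x = M'; last by move/setP/(_ x); rewrite !inE eqxx xM'.
  apply: minM'; last exact: subD1set.
  rewrite /over subsetD1 MM' xM /=; apply/exists_inP; exists A.
    by apply: (subsetP P'P).
  by rewrite AM subsetD1 xA !andbT; move: AP'; rewrite inE => /andP [].
have inP' A : (A \in P') && (A \subset M) = (A \in P ::&: M).
  rewrite !inE -andbA; congr andb; apply/andP/idP => [[]//|AM].
  by split=> //; apply: subset_trans MM'.
have cP' : #|P'| = #|P ::&: M| + #|[set A in P' | x \in A]|.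
  rewrite (cards_split P' (fun A => A \subset M)); congr (_ + _); apply: eq_card => A.
    by rewrite inE inP'.
  by rewrite !inE; apply: andb_id2l => AP'; rewrite through ?inE.
rewrite cP'.
set b := #|[set A in P' | x \in A]|.
suff split_x : #|shadow k (P ::&: M)| + b <
    #|[set Y in shadow k P' | x \notin Y]| + #|[set Y in shadow k P' | x \in Y]|.
  rewrite (cards_split (shadow k P') (fun Y => x \in Y)) addnC in split_x *.
  by move: split_x; clear; lia.
have avoid : shadow k (P ::&: M) \subset [set Y in shadow k P' | x \notin Y].
  apply/subsetP => Y /shadowP [Yk [A]]; rewrite -inP' => /andP [AP' AM] YA.
  rewrite inE; apply/andP; split; first by apply/shadowP; split=> //; exists A.
  by apply: contra xM => xY; apply/(subsetP AM)/(subsetP YA).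
have kA0 : k <= #|A0 :\ x| by have := cardsD1 x A0; rewrite xA0 (Pm A0) //; clear -km; lia.
(* If A0 lies in x |: M, two members of P' differ by at most 2 < k - 1 elements, and
   there is room to discard A0; otherwise a k-subset of A0 :\ x outside M is extra. *)
have [A0x|A0x] := boolP (A0 \subset x |: M).
  rewrite -addnS; apply: leq_add; first exact: subset_leq_card.
  have M'x : M' = x |: M.
    apply/esym/minM'; last by rewrite subUset sub1set xM'.
    rewrite /over subsetUr; apply/exists_inP; exists A0 => //.
    by rewrite A0x A0M.
  have M'm : #|M'| = m.+2 by rewrite M'x cardsU1 xM Mm.
  have P'2 : {in P' &, forall A B : {set T}, #|[set x]| + #|A :\: B| < k}.
    move=> A B; rewrite !inE => /andP [AP AM'] /andP [BP BM'].
    have : #|A :\: B| <= #|M' :\: B| by apply: subset_leq_card; apply: setSD.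
    rewrite [X in _ <= X]cardsDS // M'm (Pm B) // cards1.
    by clear -k4; lia.
  have := leq_card_shadow_outside (W := A0) P'm (ltnW km) _ P'2.
  rewrite sub1set => /(_ xA0) out.
  (* Of two k-sets through [x] inside [A0], one pays for the discarded [A0] and the other gives
     strictness. *)
  have inA0 : 1 < #|layer k [set x] A0|.
    rewrite card_layer ?sub1set ?cards1 ?(Pm A0) //; last by clear -k4; lia.
    by clear -k4 km; apply: leq_trans (leq_bin _); lia.
  have bE : b = (#|[set A in P' | ([set x] \subset A) && ~~ (A \subset A0)]|).+1.
    rewrite /b (cardsD1 A0) inE A0P' xA0 /= add1n; congr _.+1; apply: eq_card => A.
    rewrite !inE sub1set; case AP: (A \in P) => //=; rewrite ?andbF //.
    have -> : A \subset A0 = (A == A0); last by rewrite andbC -!andbA; congr andb.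
    apply/idP/eqP => [AA0|-> //].
    by apply/eqP; rewrite eqEcard AA0 !Pm /=.
  rewrite (cards_split [set Y in shadow k P' | x \in Y] (fun Y => Y \subset A0)).
  have layer_le : #|layer k [set x] A0| <=
      #|[set Y in [set Y in shadow k P' | x \in Y] | Y \subset A0]|.
    apply/subset_leq_card/subsetP => Y; rewrite [Y \in layer _ _ _]inE sub1set.
    move=> /and3P [/eqP Yk xY YA0].
    by rewrite 2!inE xY YA0 !andbT; apply/shadowP; split=> //; exists A0.
  rewrite bE; move: out.
  have -> : [set Y in shadow k P' | [set x] \subset Y & ~~ (Y \subset A0)] =
    [set Y in [set Y in shadow k P' | x \in Y] | ~~ (Y \subset A0)].
    by apply/setP => Y; rewrite !inE sub1set -!andbA.
  by clear -inA0 layer_le; lia.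
(* Containing [x] is expressed as leaving the window [~: [set x]], so that [#|A :\: B| < k]
   suffices, with [X] empty. *)
have hitx (Y : {set T}) : (set0 \subset Y) && ~~ (Y \subset ~: [set x]) = (x \in Y).
  by rewrite sub0set /= subsetC sub1set inE negbK.
rewrite -addSn; apply: leq_add; last first.
  have := leq_card_shadow_outside (X := set0) (W := ~: [set x]) P'm (ltnW km) (sub0set _).
  rewrite cards0 => /(_ P'k).
  by congr (_ <= _); apply: eq_card => Y; rewrite !inE hitx.
have /subsetPn [z zA0] := A0x; rewrite !inE negb_or => /andP [zx zM].
have [||Y [Yk zY YA0]] := @subset_interpolate _ [set z] (A0 :\ x) k.
- by rewrite sub1set !inE zx.
- by rewrite cards1 kA0; clear -k4; lia.
apply: proper_card; apply/properP; split=> //; exists Y.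
  rewrite inE; apply/andP; split; last first.
    by apply/negP => /(subsetP YA0); rewrite !inE eqxx.
  apply/shadowP; split=> //; exists A0 => //.
  exact: subset_trans YA0 (subD1set _ _).
apply/negP => /shadowP [_ [A]]; rewrite inE => /andP [_ AM] YA; case/negP: zM.
by apply: (subsetP AM); apply: (subsetP YA); apply: (subsetP zY); rewrite inE.
Qed.

Lemma card_shadow_bound m k P :
  4 <= k < m -> {in P, forall A : {set T}, #|A| = m} ->
  {in P &, forall A B : {set T}, #|A :\: B| < k} -> 3 <= #|P| ->
  three_shadow m k + #|P| <= #|shadow k P| + 3 /\
  (three_shadow m k + #|P| = #|shadow k P| + 3 ->
   exists M, [/\ #|M| = m.+1, {in P, forall A : {set T}, A \subset M}
               & #|P| = 3 \/ (k = 4 /\ #|P| = m.+1)]).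
Proof.
move=> km4 Pm Pk P3; have /andP [k4 km] := km4.
have [M /minsetP [M3 minM] _] : {M | minset (fun M => 3 <= #|P ::&: M|) M & M \subset setT}.
  apply: minset_exists; apply: leq_trans P3 _; apply: subset_leq_card.
  by apply/subsetP => A; rewrite inE subsetT => ->.
(* Three members missing [y] would fit in the smaller window [M :\ y]. *)
have M2 : {in M, forall y, #|[set A in P ::&: M | y \notin A]| <= 2}.
  move=> y yM; rewrite leqNgt; apply/negP => y3.
  have : M :\ y = M; last by move/setP/(_ y); rewrite !inE eqxx yM.
  apply: minM; last exact: subD1set.
  apply: leq_trans y3 _; apply: subset_leq_card; apply/subsetP => A.
  by rewrite !inE subsetD1 -andbA.
have PMm : {in P ::&: M, forall A : {set T}, #|A| = m} by move=> A /(subsetP (ssetI_sub _ _)) /Pm.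
have PMM : {in P ::&: M, forall A : {set T}, A \subset M}.
  by move=> A; rewrite inE => /andP [].
have win := card_shadow_window M Pm (ltnW km) Pk.
have [lt|[le Mm shape]] := card_shadow_sparse km4 PMm PMM M3 M2.
  by move: lt win; clear; lia.
split; first by move: le win; clear; lia.
have [PM|PM] := boolP (P \subset P ::&: M).
  have PE : P ::&: M = P by apply/eqP; rewrite eqEsubset ssetI_sub.
  by move=> _; exists M; split=> //; rewrite -PE.
have := card_shadow_window_lt km4 Pm Pk Mm PM.
by move: le; clear; lia.
Qed.

(** * Families of m-subsets of an (m+1)-set *)

Lemma cosingletons m P M :
  {in P, forall A : {set T}, #|A| = m} -> {in P, forall A : {set T}, A \subset M} ->
  #|M| = m.+1 ->
  exists X, [/\ X \subset M, #|X| = #|P| & P = [set M :\ x | x in X]].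
Proof.
move=> Pm PM Mm; pose X := [set x in M | M :\ x \in P].
have PE : P = [set M :\ x | x in X].
  apply/setP => A; apply/idP/imsetP => [AP|[x]]; last by rewrite inE => /andP [_ xP] ->.
  have /cards1P [x xE] : #|M :\: A| == 1 by rewrite cardsDS ?PM // Mm Pm // subSnn.
  have AE : A = M :\ x by rewrite -xE setDDr setDv set0U (setIidPr (PM _ AP)).
  exists x => //; rewrite inE -AE AP andbT.
  by have : x \in M :\: A; [rewrite xE inE | rewrite inE => /andP []].
exists X; split=> //; first by apply/subsetP => x; rewrite inE => /andP [].
rewrite PE card_in_imset // => x y; rewrite !inE => /andP [xM _] /andP [yM _].
move=> E; apply/eqP/contraT => xy.
by move/setP/(_ x): E; rewrite !inE eqxx xy xM.
Qed.

(** Iterated Pascal gives ['C(m.+1, k)] as [three_shadow m k] plus ['C(m - 2, k - 3)]. With three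
    members, no shadow set contains all three omitted points, which removes the last term. With
    [k = 4] and all m-subsets, that term is [m - 2 = #|P| - 3]. *)
Lemma card_shadow_extremal m k P M :
  4 <= k < m -> {in P, forall A : {set T}, #|A| = m} ->
  {in P, forall A : {set T}, A \subset M} -> #|M| = m.+1 ->
  #|P| = 3 \/ (k = 4 /\ #|P| = m.+1) ->
  three_shadow m k + #|P| = #|shadow k P| + 3.
Proof.
move=> km4 Pm PM Mm shape; have /andP [k4 km] := km4.
have [||le _] := @card_shadow_bound m k P km4 Pm.
- move=> A B AP BP; apply: leq_ltn_trans (_ : 1 < k); last by lia.
  apply: leq_trans (subset_leq_card (setSD _ (PM _ AP))) _.
  by rewrite cardsDS ?PM // Mm (Pm B) //; clear; lia.
- by case: shape => [->|[_ ->]] //; clear -km k4; lia.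
apply/eqP; rewrite eqn_leq le /= {le}; have [X [XM XP PE]] := cosingletons Pm PM Mm.
have sub : shadow k P \subset layer k set0 M.
  apply/subsetP => Y /shadowP [Yk [A AP YA]].
  by rewrite inE Yk eqxx sub0set (subset_trans YA) ?PM.
have b1 : 'C(m.+1, k) = 'C(m, k) + 'C(m, k - 1) by rewrite bin_pascal ?subn1 //; lia.
have b2 : 'C(m, k - 1) = 'C(m - 1, k - 1) + 'C(m - 1, k - 2).
  by rewrite bin_pascal -?subnDA //; lia.
have b3 : 'C(m - 1, k - 2) = 'C(m - 2, k - 2) + 'C(m - 2, k - 3).
  by rewrite bin_pascal -?subnDA //; lia.
have cM : #|layer k set0 M| = 'C(m.+1, k) by rewrite card_layer ?sub0set ?cards0 // !subn0 Mm.
have [P3|[k4' Pm1]] := shape; last first.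
  have b4 : 'C(m - 2, k - 3) = m - 2 by rewrite k4' bin1.
  move: (subset_leq_card sub); rewrite cM Pm1 /three_shadow.
  by set s := #|shadow k P|; clear -b1 b2 b3 b4 km k4; lia.
have disj : shadow k P \subset layer k set0 M :\: layer k X M.
  rewrite subsetD sub disjoints_subset; apply/subsetP => Y /shadowP [Yk [A]].
  rewrite PE => /imsetP [x xX ->] YM; rewrite !inE Yk eqxx /=.
  by apply/negP => /andP [XY _]; have := subsetP YM _ (subsetP XY _ xX); rewrite !inE eqxx.
have := subset_leq_card disj; rewrite cardsDS; last first.
  by apply/subsetP => Y; rewrite !inE sub0set => /and3P [-> _ ->].
rewrite cM card_layer // XP P3 ?Mm /three_shadow; last by clear -k4; lia.
by set s := #|shadow k P|; rewrite subSS; clear -b1 b2 b3 k4 km; lia.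
Qed.

End ShadowBound.
(** * Cross-intersecting families on [n] *)

Section Families.

Variable n : nat.
Implicit Types (A B K M X : {set 'I_n}) (F G : {set {set 'I_n}}) (s : 'S_n).

(** The largest family of k-sets cross-intersecting with [F]. *)
Definition transversals k F :=
  [set B in ksubsets n k | [forall A in F, A :&: B != set0]].

Lemma transversalsP k F B :
  reflect (#|B| = k /\ {in F, forall A, A :&: B != set0}) (B \in transversals k F).
Proof. by rewrite !inE; apply: (iffP andP) => -[/eqP ? /forall_inP ?]. Qed.

Definition family_compl F : {set {set 'I_n}} := [set ~: A | A in F].

Lemma card_family_compl F : #|family_compl F| = #|F|.
Proof. by rewrite card_imset //; apply: inv_inj; apply: setCK. Qed.

Lemma card_transversals k F :
  #|transversals k F| + #|shadow k (family_compl F)| = 'C(n, k).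
Proof.
rewrite -[in RHS](card_ord n) -card_draws addnC.
rewrite (cards_split [set A : {set 'I_n} | #|A| == k] (fun Y => Y \in shadow k (family_compl F))).
congr (_ + _); apply: eq_card => B; rewrite !inE; first by case: (#|B| == k).
case: (#|B| == k) => //=; rewrite negb_exists_in; apply/forall_inP/forall_inP.
  by move=> BF _ /imsetP [A AF ->]; rewrite -disjoints_subset -setI_eq0 setIC BF.
move=> BF A AF; have := BF (~: A) (imset_f _ AF).
by rewrite -disjoints_subset -setI_eq0 setIC.
Qed.

Lemma family_compl_uniform m F :
  {in F, forall A, #|A| = m} -> {in family_compl F, forall A : {set 'I_n}, #|A| = n - m}.
Proof.
move=> Fm _ /imsetP [A AF ->]; rewrite -(Fm _ AF).
by have := cardsC A; rewrite card_ord; clear; lia.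
Qed.

Lemma cross_intersecting_transversals k F G :
  G \subset ksubsets n k -> cross_intersecting F G -> G \subset transversals k F.
Proof.
move=> /subsetP Gk FG; apply/subsetP => B BG; apply/transversalsP.
by split=> [|A AF]; [have := Gk _ BG; rewrite inE => /eqP | apply: FG].
Qed.

(** For [X] disjoint from [K], a sunflower with kernel [K] and one-point petals; both extremal
    families have this form. *)
Definition star K X := [set x |: K | x in X].

Lemma card_star K X : X \subset ~: K -> #|star K X| = #|X|.
Proof.
move=> XK; apply: card_in_imset => x y xX yX /setP/(_ x).
have := subsetP XK _ xX; rewrite !inE eqxx => /negPf -> /=.
by rewrite orbF => /esym/eqP.
Qed.

Lemma star_uniform K X : X \subset ~: K -> {in star K X, forall A, #|A| = #|K|.+1}.
Proof.
move=> XK _ /imsetP [x xX ->]; rewrite cardsU1.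
by have := subsetP XK _ xX; rewrite inE => ->.
Qed.

(** The complements of the members are the sets [~: K] minus one point of [X], so
    [card_shadow_extremal] applies inside [~: K]. *)
Lemma card_star_transversals k t K X :
  4 <= k -> 2 * k + t < n -> #|K| = k + t - 1 -> X \subset ~: K ->
  #|X| = 3 \/ (k = 4 /\ X = ~: K) ->
  #|star K X| + #|transversals k (star K X)| + three_shadow (n - k - t) k = 'C(n, k) + 3.
Proof.
move=> k4 nk Kk XK shape.
have KC : #|~: K| = (n - k - t).+1.
  have := cardsC K; rewrite card_ord Kk; clear -nk k4; lia.
have := @card_shadow_extremal _ (n - k - t) k (family_compl (star K X)) (~: K).
have -> : 3 < k < n - k - t by clear -k4 nk; lia.
move=> /(_ isT) H; have {}H := H _ _ KC.
have := card_transversals k (star K X); rewrite card_family_compl card_star // in H *.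
have {}H : three_shadow (n - k - t) k + #|X| =
    #|shadow k (family_compl (star K X))| + 3.
  apply: H => [A|A|].
  - move=> /(family_compl_uniform (star_uniform XK)) ->.
    by rewrite Kk; clear -k4; lia.
  - by move=> /imsetP [_ /imsetP [x xX ->] ->]; rewrite setCS subsetUr.
  - by case: shape => [X3|[kE XE]]; [left | right; split=> //; rewrite XE KC].
by move: H; clear; lia.
Qed.

(** The difference of the complements of [A] and [B] is [B :\: A], of size at most
    [k + t - (t + 1) < k], so [card_shadow_bound] applies. In case of equality [G] fills
    [transversals k F], and the complement of the window [M] is the kernel. *)
Lemma extremal_star k t F G :
  4 <= k -> 2 * k + t < n -> F \subset ksubsets n (k + t) -> G \subset ksubsets n k ->
  cross_intersecting F G -> s_intersecting (t + 1) F -> 3 <= #|F| ->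
  #|F| + #|G| + three_shadow (n - k - t) k <= 'C(n, k) + 3 /\
  (#|F| + #|G| + three_shadow (n - k - t) k = 'C(n, k) + 3 ->
   exists K X, [/\ #|K| = k + t - 1, X \subset ~: K, #|X| = 3 \/ (k = 4 /\ X = ~: K),
                   F = star K X & G = transversals k F]).
Proof.
move=> k4 nk Fk Gk FG Ft F3; set m := n - k - t.
have F_uniform : {in F, forall A, #|A| = k + t}.
  by move=> A /(subsetP Fk); rewrite inE => /eqP.
have GT := cross_intersecting_transversals Gk FG.
have GT_le := subset_leq_card GT.
have T_eq := card_transversals k F.
have compl_m : {in family_compl F, forall A : {set 'I_n}, #|A| = m}.
  by move=> A /(family_compl_uniform F_uniform) ->; rewrite subnDA.
have compl_diff : {in family_compl F &, forall A B : {set 'I_n}, #|A :\: B| < k}.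
  move=> _ _ /imsetP [A AF ->] /imsetP [B BF ->].
  rewrite setDE setCK setIC -setDE cardsD F_uniform //.
  by have := Ft _ _ BF AF; clear -k4; lia.
have km4 : 3 < k < m by rewrite /m; clear -k4 nk; lia.
have [] := card_shadow_bound km4 compl_m compl_diff; rewrite card_family_compl // => le eq.
split; first by move: le GT_le T_eq; clear; lia.
move=> E.
have sh_eq : three_shadow m k + #|F| = #|shadow k (family_compl F)| + 3.
  by move: E le GT_le T_eq; clear; lia.
have [M [Mm FM shape]] := eq sh_eq.
have [X [XM XF FE]] := cosingletons compl_m FM Mm.
have Fstar : F = star (~: M) X.
  apply: (imset_inj (f := @setC _)); first exact: inv_inj (@setCK _).
  rewrite [LHS]FE -imset_comp; apply: eq_imset => x /=.
  by rewrite setCU setCK setDE setIC.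
exists (~: M), X; split=> //.
- by have := cardsC M; rewrite card_ord Mm /m; clear -nk k4; lia.
- by rewrite setCK.
- rewrite XF card_family_compl setCK; case: shape => [|[-> Fm]]; [by left | right].
  by split=> //; apply/eqP; rewrite eqEcard XM XF card_family_compl Fm Mm leqnn.
- apply/eqP; rewrite eqEcard GT /=.
  move: E sh_eq T_eq; set f := #|F|; set g := #|G|; set tr := #|transversals k F|.
  by set sh := #|shadow k _|; clear; lia.
Qed.

(** * Moving stars to standard position by a permutation *)

Lemma card_fam_image s F : #|fam_image s F| = #|F|.
Proof. by apply/card_imset/imset_inj/perm_inj. Qed.

Lemma fam_image_transversals s k F :
  fam_image s (transversals k F) = transversals k (fam_image s F).
Proof.
have meet A B : (s @: A :&: s @: B == set0) = (A :&: B == set0).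
  by rewrite -imsetI ?imset_eq0 // => x y _ _; apply: perm_inj.
apply/setP => B; apply/imsetP/transversalsP => [[C /transversalsP [Ck FC] ->]|[Bk FB]].
  split=> [|_ /imsetP [A AF ->]]; first by rewrite card_imset //; apply: perm_inj.
  by rewrite meet FC.
have BE : B = s @: ((s^-1)%g @: B).
  rewrite -imset_comp -[LHS]imset_id; apply: eq_imset => x /=.
  by rewrite permKV.
exists ((s^-1)%g @: B) => //; apply/transversalsP; split=> [|A AF].
  by rewrite card_imset //; apply: perm_inj.
by rewrite -meet -BE FB // imset_f.
Qed.

Lemma fam_image_star s K X : fam_image s (star K X) = star (s @: K) (s @: X).
Proof.
rewrite /fam_image /star -!imset_comp; apply: eq_imset => x /=.
by rewrite imsetU imset_set1.
Qed.

(** Append to [l] the remaining elements of the ground set; the position in this list is a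
    permutation. *)
Lemma perm_index (l : seq 'I_n) :
  uniq l -> exists s, {in l, forall x, s x = index x l :> nat}.
Proof.
move=> l_uniq; pose l' := l ++ [seq x <- enum 'I_n | x \notin l].
have l'_perm : perm_eq l' (enum 'I_n).
  apply: uniq_perm; rewrite ?enum_uniq //.
    rewrite cat_uniq l_uniq filter_uniq ?enum_uniq // andbT /=.
    by apply/hasPn => x; rewrite mem_filter => /andP [].
  by move=> x; rewrite mem_cat mem_filter mem_enum; case: (x \in l).
have mem_l' x : x \in l' by rewrite (perm_mem l'_perm) mem_enum.
have idx x : index x l' < n.
  by rewrite -{2}(size_enum_ord n) -(perm_size l'_perm) index_mem.
have idx_inj : injective (fun x => Ordinal (idx x)).
  by move=> x y [] /(congr1 (nth x l')); rewrite !nth_index.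
by exists (perm idx_inj) => x xl; rewrite permE /= index_cat xl.
Qed.

Lemma card_seg m : m <= n -> #|seg n m| = m.
Proof.
move=> mn; have inj : injective (widen_ord mn) by move=> x y /(congr1 val) ?; apply: val_inj.
rewrite -[RHS]card_ord -(card_imset _ inj).
apply: eq_card => x; apply/idP/imsetP => [|[y _ ->]]; rewrite inE; last exact: (ltn_ord y).
by move=> xm; exists (Ordinal xm) => //; apply: val_inj.
Qed.

Lemma perm_seg K (r : seq 'I_n) :
  uniq r -> {in r, forall x, x \notin K} ->
  exists s, s @: K = seg n #|K| /\ {in r, forall x, s x = #|K| + index x r :> nat}.
Proof.
move=> r_uniq rK.
have [|s sE] := @perm_index (enum K ++ r).
  rewrite cat_uniq enum_uniq r_uniq andbT /=.
  by apply/hasPn => x /rK; rewrite mem_enum.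
exists s; split=> [|x xr].
  have Kn : #|K| <= n by rewrite -[X in _ <= X]card_ord max_card.
  apply/eqP; rewrite eqEcard card_seg // card_imset ?leqnn ?andbT; last exact: perm_inj.
  apply/subsetP => _ /imsetP [x xK ->]; rewrite inE sE ?mem_cat ?mem_enum ?xK //.
  by rewrite index_cat mem_enum xK cardE index_mem mem_enum.
by rewrite sE ?mem_cat ?xr ?orbT // index_cat mem_enum (negPf (rK _ xr)) cardE.
Qed.

Lemma petal_star k t :
  0 < k -> k + t + 2 <= n ->
  exists X, [/\ X \subset ~: seg n (k + t - 1), #|X| = 3
    & [set petal n k t 1; petal n k t 2; petal n k t 3] = star (seg n (k + t - 1)) X].
Proof.
move=> k0 kn.
(* The ordinal of value [k + t - 1 + i] stands for the integer one larger, hence the index [i.+1] of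
   the petal. *)
have pt i : i < 3 -> exists2 x : 'I_n, val x = k + t - 1 + i &
    petal n k t i.+1 = x |: seg n (k + t - 1).
  move=> i3; have xn : k + t - 1 + i < n by move: i3 kn k0; clear; lia.
  exists (Ordinal xn) => //; apply/setP => y; rewrite !inE orbC addnS eqSS.
  by rewrite -val_eqE.
have [//|x xE ->] := pt 0; have [//|y yE ->] := pt 1; have [//|z zE ->] := pt 2.
exists [set x; y; z]; split.
- apply/subsetP => u; rewrite !inE -leqNgt -!val_eqE xE yE zE.
  by move=> /orP [/orP [] /eqP ->|/eqP ->]; rewrite leq_addr.
- by rewrite -setUA cardsU1 cards2 !inE -!val_eqE xE yE zE !eqn_add2l.
- by rewrite /star !imsetU !imset_set1.
Qed.

Lemma extremal1P k t F G :
  extremal1 k t F G <->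
  F = [set petal n k t 1; petal n k t 2; petal n k t 3] /\ G = transversals k F.
Proof.
rewrite /extremal1.
suff <- : transversals k [set petal n k t 1; petal n k t 2; petal n k t 3] =
  [set B in ksubsets n k | [&& B :&: petal n k t 1 != set0, B :&: petal n k t 2 != set0
                             & B :&: petal n k t 3 != set0]].
  by split=> [[-> ->]|[-> ->]].
apply/setP => B; rewrite !inE; congr andb.
apply/forall_inP/and3P => [FB|[B1 B2 B3] A].
  by split; rewrite setIC FB // !inE eqxx ?orbT.
by rewrite !inE setIC => /orP [/orP [] /eqP ->|/eqP ->].
Qed.

(** A set meeting every member of the star but not its kernel contains the whole complement of the
    kernel, which has more than four points. *)
Lemma extremal2P k t F G :
  8 + t < n ->
  extremal2 k t F G <->
  [/\ k = 4, F = star (seg n (t + 3)) (~: seg n (t + 3)) & G = transversals k F].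
Proof.
move=> tn; rewrite /extremal2.
have FE : [set seg n (t + 3) :|: [set x] | x : 'I_n & t + 4 <= x.+1] =
    star (seg n (t + 3)) (~: seg n (t + 3)).
  rewrite /star; apply/setP => A; apply/imsetP/imsetP => -[x]; rewrite !inE => xt ->;
    exists x; rewrite ?inE 1?setUC //; by move: xt; clear; lia.
rewrite FE.
suff TE : transversals 4 (star (seg n (t + 3)) (~: seg n (t + 3))) =
    [set B in ksubsets n 4 | B :&: seg n (t + 3) != set0].
  by split=> [[-> -> ->]|[-> -> ->]]; rewrite TE.
apply/setP => B; rewrite !inE; apply: andb_id2l => /eqP B4.
apply/forall_inP/idP => [FB|]; last first.
  move=> /set0Pn [y]; rewrite inE => /andP [yB yK] _ /imsetP [x _ ->].
  by apply/set0Pn; exists y; rewrite inE yB inE yK orbT.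
apply: contraT; rewrite negbK => /eqP BK.
have /subsetPn [x] : ~~ (~: seg n (t + 3) \subset B).
  have tn' : t + 3 <= n by clear -tn; lia.
  apply/negP => /subset_leq_card; have := cardsC (seg n (t + 3)).
  by rewrite card_ord (card_seg tn') [#|B|]B4; clear -tn; lia.
rewrite inE => xK xB; have := FB (x |: seg n (t + 3)) (imset_f _ _).
rewrite inE xK => /(_ isT) /set0Pn [y]; rewrite !inE => /andP [/orP [/eqP ->|yK] yB].
  by rewrite yB in xB.
by move/setP/(_ y): BK; rewrite !inE yB yK.
Qed.

Lemma star_extremal k t K X :
  4 <= k -> 2 * k + t < n -> #|K| = k + t - 1 -> X \subset ~: K ->
  #|X| = 3 \/ (k = 4 /\ X = ~: K) ->
  exists s, extremal1 k t (fam_image s (star K X)) (fam_image s (transversals k (star K X)))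
   \/ extremal2 k t (fam_image s (star K X)) (fam_image s (transversals k (star K X))).
Proof.
move=> k4 nk Kk XK [X3|[kE ->]]; last first.
  (* Only the kernel has to be placed, since [X] is its complement. *)
  have [|s [sK _]] := @perm_seg K [::] isT; first by [].
  exists s; right; rewrite fam_image_transversals fam_image_star.
  apply/extremal2P; first by move: nk; rewrite kE; clear; lia.
  have KE : k + t - 1 = t + 3 by rewrite kE; clear; lia.
  have sKC : s @: (~: K) = ~: (s @: K) by rewrite !(can_imset_pre _ (permK s)) preimsetC.
  by rewrite -KE -Kk -sK sKC.
have /card_gt2P [x [y [z [[xX yX zX] [xy yz zx]]]]] : 2 < #|X| by rewrite X3.
have c3 : #|[set x; y; z]| = 3.
  by rewrite -setUA cardsU1 cards2 !inE negb_or xy yz eq_sym zx.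
have XE : X = [set x; y; z].
  apply/esym/eqP; rewrite eqEcard X3 c3 leqnn andbT.
  by apply/subsetP => u; rewrite !inE => /orP [/orP [] /eqP ->|/eqP ->].
have [|u|s [sK sX]] := @perm_seg K [:: x; y; z].
- by rewrite /= !inE negb_or xy yz eq_sym zx.
- rewrite !inE => u3; have : u \in X by rewrite XE !inE -orbA.
  by move=> /(subsetP XK); rewrite inE.
exists s; left; rewrite fam_image_transversals fam_image_star; apply/extremal1P.
split=> //.
rewrite XE !imsetU !imset_set1 /star !imsetU !imset_set1 sK Kk /petal.
have pt u i : u \in [:: x; y; z] -> index u [:: x; y; z] = i ->
    s u |: seg n (k + t - 1) = petal n k t i.+1.
  move=> uX ui; apply/setP => v; rewrite !inE orbC -val_eqE /= sX // ui Kk.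
  by rewrite addnS eqSS.
have iy : index y [:: x; y; z] = 1 by rewrite /= (negPf xy) eqxx.
have iz : index z [:: x; y; z] = 2 by rewrite /= (negPf yz) eq_sym (negPf zx) eqxx.
by rewrite (pt x 0) ?(pt y 1) ?(pt z 2) ?inE ?eqxx ?orbT //=; rewrite eqxx.
Qed.

Lemma extremal_card k t F G :
  4 <= k -> 2 * k + t < n -> extremal1 k t F G \/ extremal2 k t F G ->
  #|F| + #|G| + three_shadow (n - k - t) k = 'C(n, k) + 3.
Proof.
move=> k4 nk [/extremal1P [-> ->]|].
  have [||X [XK X3 ->]] := @petal_star k t; try by move: k4 nk; clear; lia.
  apply: (@card_star_transversals k t (seg n (k + t - 1))) => //; last by left.
  by apply: card_seg; move: nk; clear; lia.
move=> E; have /extremal2P E' := E.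
have kE : k = 4 by case: E.
have [|_ -> ->] := E'; first by move: nk; rewrite kE; clear; lia.
apply: (@card_star_transversals k t) => //; last by right.
have tn : t + 3 <= n by move: nk; rewrite kE; clear; lia.
by rewrite (card_seg tn) kE; clear; lia.
Qed.

(** Here the complements are themselves k-sets, so each lies in the shadow and [#|F|] is at most its
    size, while [three_shadow k k] is 3 and cancels the constant. *)
Lemma tight_bound k t F G :
  n = 2 * k + t -> 2 <= k -> F \subset ksubsets n (k + t) -> G \subset ksubsets n k ->
  cross_intersecting F G ->
  #|F| + #|G| + three_shadow (n - k - t) k <= 'C(n, k) + 3.
Proof.
move=> nE k2 Fk Gk FG.
have -> : n - k - t = k by rewrite nE; clear; lia.
have GT := subset_leq_card (cross_intersecting_transversals Gk FG).
have : #|F| <= #|shadow k (family_compl F)|.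
  rewrite -card_family_compl; apply/subset_leq_card/subsetP => A AF.
  apply/shadowP; split; last by exists A.
  rewrite (family_compl_uniform (m := k + t) _ AF); first by rewrite nE; clear; lia.
  by move=> B /(subsetP Fk); rewrite inE => /eqP.
have := card_transversals k F; rewrite /three_shadow !binn.
by move: GT; clear; lia.
Qed.

End Families.

(** * The bound and its equality cases over the integers *)

Local Open Scope ring_scope.

Theorem theorem1p4 (k t n : nat) (F G : {set {set 'I_n}})
  (hk : (4 <= k)%N) (hn : (2 * k + t <= n)%N)
  (hF : F \subset ksubsets n (k + t)) (hG : G \subset ksubsets n k)
  (hcross : cross_intersecting F G)
  (hint : s_intersecting (t + 1) F) (hcard : (3 <= #|F|)%N) :
  let bound : int :=
    'C(n, k)%:Z - 'C(n - k - t, k)%:Z - 'C(n - k - t - 1, k - 1)%:Z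
      - 'C(n - k - t - 2, k - 2)%:Z + 3 in
  #|F|%:Z + #|G|%:Z <= bound /\
  ((2 * k + t < n)%N ->
   (#|F|%:Z + #|G|%:Z = bound <->
    exists s : 'S_n,
      extremal1 k t (fam_image s F) (fam_image s G) \/
      extremal2 k t (fam_image s F) (fam_image s G))).
Proof.
move=> bound.
(* This links the integer differences to the subtraction-free inequalities on naturals proved
   above. *)
have boundE : bound = ('C(n, k) + 3)%N%:Z - (three_shadow (n - k - t) k)%:Z.
  by rewrite /bound /three_shadow; clear; lia.
have [nk|nk] : (2 * k + t < n)%N \/ n = (2 * k + t)%N by move: hn; clear; lia.
  have [le eq] := extremal_star hk nk hF hG hcross hint hcard.
  split; first by rewrite boundE; move: le; clear; lia.
  move=> _; split=> [E|[s /(extremal_card hk nk)]]; last first.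
    by rewrite !card_fam_image boundE; clear; lia.
  have [|K [X [Kk XK shape FE GE]]] := eq.
    by move: E; rewrite boundE; clear; lia.
  by rewrite GE FE; apply: star_extremal.
split; last by move=> lt_n; exfalso; move: lt_n nk; clear; lia.
have le := tight_bound nk (ltnW (ltnW hk)) hF hG hcross.
by rewrite boundE; move: le; clear; lia.
Qed.
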